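(* Let $b\ge 2$ and $d\ge 1$ be integers, let $a_1,\dots,a_d$ be positive integers each coprime to $b$, and put $\xi=e^{2\pi i/b}$. Let $f,g:\mathbb{Z}\to\mathbb{C}$ be $b$-periodic functions with $\sum_{k=0}^{b-1}f(k)=\sum_{k=0}^{b-1}g(k)=0$. Then \[(I-T^{a_1})(I-T^{a_2})\cdots(I-T^{a_d})(f*g)=g\] holds if and only if \[\hat f(k)=\frac{1}{(1-\xi^{ka_1})(1-\xi^{ka_2})\cdots(1-\xi^{ka_d})}\] for every $k\in\{0,1,\dots,b-1\}$ with $\hat g(k)\neq 0$. In particular, if $\hat g(k)\ne 0$ for all $1\le k\le b-1$ and the equation holds, then $f(t)=S_{(a_1,\dots,a_d;b)}(t)$ for all $t\in\mathbb{Z}$.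
   Context: $I$ is the identity operator and $T^a$ is the shift operator $(T^a h)(t)=h(t+a)$. For $b$-periodic $f,g$ the convolution is $(f*g)(t)=\sum_{m=0}^{b-1}f(t-m)g(m)$. The discrete Fourier transform is $\hat f(k)=\sum_{m=0}^{b-1}f(m)\xi^{-km}$, so that $f(n)=\frac1b\sum_{k=0}^{b-1}\hat f(k)\xi^{nk}$ (note $\hat f(0)=\hat g(0)=0$ under the hypotheses). The Fourier–Dedekind sum is $S_{(a_1,\dots,a_d;b)}(n)=\frac1b\sum_{j=1}^{b-1}\frac{\xi_b^{jn}}{(1-\xi_b^{ja_1})\cdots(1-\xi_b^{ja_d})}$ with $\xi_b=e^{2\pi i/b}$. *)

(* Defs.v *)
From mathcomp Require Import all_boot all_order all_algebra.
From mathcomp Require Import reals sequences exp trigo.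
From mathcomp Require Import complex.
From mathcomp Require Import functions.

Set Implicit Arguments.
Unset Strict Implicit.
Unset Printing Implicit Defensive.

Import GRing.Theory.
Local Open Scope ring_scope.
Local Open Scope complex_scope.

Definition cexp (R : realType) (z : R[i]) : R[i] :=
  (expR (complex.Re z))%:C
    * (cos (complex.Im z) +i* sin (complex.Im z)).

(* xi_b = e^(2 pi i / b), where [r *i] is the purely imaginary number i r. *)
Definition xi (R : realType) (b : nat) : R[i] :=
  cexp ((2 * pi / b%:R) *i).

Definition shift_op (R : realType) (a : int) (h : int -> R[i]) : int -> R[i] :=
  fun t => h (t + a).

(* On operators, [\-] is the pointwise difference (I - T^a) h = h - T^a h, and
   [comp] puts the factor of index 0 leftmost (outermost). *)
Definition shift_prod (R : realType) (d : nat) (a : 'I_d -> nat) :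
    (int -> R[i]) -> (int -> R[i]) :=
  \big[comp/idfun]_(i < d) (idfun \- @shift_op R (a i)%:Z).

Definition conv (R : realType) (b : nat) (f g : int -> R[i]) : int -> R[i] :=
  fun t => \sum_(m < b) f (t - m%:Z) * g m%:Z.

Definition dft (R : realType) (b : nat) (f : int -> R[i]) (k : int) : R[i] :=
  \sum_(m < b) f m%:Z * xi R b ^ (- (k * m%:Z)).

Definition fourier_dedekind (R : realType) (d : nat) (a : 'I_d -> nat)
    (b : nat) (n : int) : R[i] :=
  b%:R^-1 * \sum_(1 <= j < b)
    (xi R b ^ (j%:Z * n) / \prod_(i < d) (1 - xi R b ^ (j%:Z * (a i)%:Z))).

(* Main.v *)
(* The Fourier transform turns convolution into a product and T^a into
   multiplication by xi^(k a), so the equation says, frequency by frequency,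
   that (1 - xi^(k a_1)) ... (1 - xi^(k a_d)) f^(k) g^(k) = g^(k).  The
   frequency k = 0 is harmless since g^(0) = 0, and coprimality makes the
   factors nonzero at the others. *)
Require Import Defs.
From mathcomp Require Import all_boot all_order all_algebra.
From mathcomp Require Import boolp reals sequences exp trigo.
From mathcomp Require Import complex.
From mathcomp Require Import functions.
From mathcomp Require Import ring lra.

Import Order.TTheory GRing.Theory Num.Theory.
Local Open Scope ring_scope.
Local Open Scope complex_scope.

Lemma xiE (R : realType) (b : nat) :
  xi R b = cos (2 * pi / b%:R) +i* sin (2 * pi / b%:R).
Proof. by rewrite /xi /cexp /= expR0 mul1r. Qed.

Lemma de_Moivre (R : realType) (x : R) (n : nat) :
  (cos x +i* sin x) ^+ n = cos (n%:R * x) +i* sin (n%:R * x).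
Proof.
elim: n => [|n IHn]; first by rewrite mul0r cos0 sin0.
rewrite exprS IHn -natr1 mulrDl mul1r addrC cosD sinD; simpc.
by congr (_ +i* _); ring.
Qed.

(** The half angle lies in (0, pi), where sine is positive, and cos x = 1 - 2 sin^2 (x/2). *)
Lemma cos_lt1 (R : realType) (x : R) : 0 < x < 2 * pi -> cos x < 1.
Proof.
move=> /andP[x0 xpi].
have s0 : 0 < sin (x / 2) by apply: sin_gt0_pi; apply/andP; split; lra.
have -> : x = (x / 2) *+ 2 by rewrite -mulr_natr; field.
rewrite cos_mulr2n cos2sin2.
have : 0 < sin (x / 2) ^+ 2 by rewrite exprn_gt0.
lra.
Qed.

(** For 0 < k < b the angle 2 pi k / b lies strictly between 0 and 2 pi, so the real part of
    [xi R b ^+ k] is below 1 and no smaller power returns to 1. *)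
Lemma xi_prim_root (R : realType) (b : nat) :
  (0 < b)%N -> b.-primitive_root (xi R b).
Proof.
move=> b0; have bR0 : 0 < b%:R :> R by rewrite ltr0n.
apply/andP; split=> //; apply/forallP => k; apply/eqP.
rewrite unity_rootE xiE de_Moivre; case: (eqVneq k.+1 b) => [->|kb].
  rewrite mulrC divfK ?(gt_eqF bR0)// mulr_natl cos2pi sin2pi.
  by rewrite eqxx.
have kltb : (k.+1 < b)%N by rewrite ltn_neqAle kb ltn_ord.
apply/negP => /eqP [/eqP]; rewrite lt_eqF//; apply: cos_lt1.
apply/andP; split; first by rewrite !mulr_gt0 ?invr_gt0 ?pi_gt0.
rewrite [ltLHS]mulrA ltr_pdivrMr// [ltRHS]mulrC ltr_pM2r ?ltr_nat//.
by rewrite mulr_gt0 ?pi_gt0.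
Qed.

(** Orthogonality of characters: for 0 < m < n this is a geometric sum with ratio different from 1
    whose n-th power is 1. *)
Lemma sum_prim_rootV (F : fieldType) (n m : nat) (z : F) :
  n.-primitive_root z -> (m < n)%N ->
  \sum_(k < n) (z ^- m) ^+ k = if m == 0%N then n%:R else 0.
Proof.
move=> pz mn; case: eqP => [->|/eqP m0].
  under eq_bigr do rewrite invr1 expr1n.
  by rewrite sumr_const card_ord.
have zm1 : z ^- m - 1 != 0.
  by rewrite subr_eq0 invr_eq1 -(prim_order_dvd pz) gtnNdvd// lt0n.
apply: (mulfI zm1); rewrite -subrX1 mulr0 exprVn -exprM mulnC exprM.
by rewrite (prim_expr_order pz) expr1n invr1 subrr.
Qed.

(** A unit shift trades the first term of the window for the one b places later, equal to it by
    periodicity; induction on [a] in both directions does the rest. *)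
Lemma sum_periodic_shift (V : zmodType) (b : nat) (h : int -> V) (a : int) :
  periodic h b%:Z -> \sum_(m < b) h (m%:Z + a) = \sum_(m < b) h m%:Z.
Proof.
move=> hh; have S (c : int) : \sum_(m < b) h (m%:Z + (c + 1)) = \sum_(m < b) h (m%:Z + c).
  case: b hh => [|b] hh; first by rewrite !big_ord0.
  rewrite big_ord_recr [RHS]big_ord_recl [LHS]addrC; congr (_ + _).
    by rewrite -[RHS]hh intS /=; congr h; ring.
  by apply: eq_bigr => i _; congr h; rewrite lift0 intS /=; ring.
elim/int_ind: a => [|n <-|n <-].
- by apply: eq_bigr => i _; rewrite addr0.
- by rewrite -[RHS]S; apply: eq_bigr => i _; congr h; rewrite intS; ring.
- by rewrite -S; apply: eq_bigr => i _; congr h; rewrite intS; ring.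
Qed.

Section DiscreteFourier.
Variables (R : realType) (b : nat).
Hypothesis b_gt0 : (0 < b)%N.
Implicit Types (f g h : int -> R[i]) (k : int).
Local Notation z := (xi R b).

Let z0 : z != 0.
Proof. by rewrite (prim_root_eq0 (xi_prim_root R b b_gt0)) -lt0n. Qed.

Lemma xi_exprz_periodic k : periodic (fun n : int => z ^ (k * n)) b%:Z.
Proof.
move=> n; rewrite mulrDr expfzDr// [k * b%:Z]mulrC -(exprz_exp _ b%:Z).
by rewrite -exprnP (prim_expr_order (xi_prim_root R b b_gt0)) exp1rz mulr1.
Qed.

(** The summand of the transform is itself b-periodic, so its window may be moved by [a]. The raw
    sum on the left fits convolution ([a] is [-m]), inversion ([a] is [n]) and the shift operators
    alike. *)
Lemma dft_shift h k (a : int) : periodic h b%:Z ->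
  \sum_(m < b) h (m%:Z + a) * z ^ (- (k * m%:Z)) = z ^ (k * a) * dft b h k.
Proof.
move=> hh; rewrite /dft.
have ph : periodic (fun n => h n * z ^ (- (k * n))) b%:Z.
  by move=> n /=; rewrite hh -!mulNr xi_exprz_periodic.
rewrite -(sum_periodic_shift _ _ _ a ph) mulr_sumr; apply: eq_bigr => i _.
by rewrite mulrCA -expfzDr//; congr (_ * z ^ _); ring.
Qed.

Lemma periodic_conv f g : periodic f b%:Z -> periodic (conv b f g) b%:Z.
Proof.
by move=> hf t; apply: eq_bigr => i _; rewrite addrAC hf.
Qed.

Lemma dft_conv f g k : periodic f b%:Z ->
  dft b (conv b f g) k = dft b f k * dft b g k.
Proof.
move=> hf; rewrite {1}/dft /conv.
under eq_bigr do rewrite mulr_suml.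
(* With [m] outermost, the inner sum is the transform of [f] shifted by [-m]; the resulting factor
   z^(-km) completes the transform of [g]. *)
rewrite exchange_big /= [dft b g k]/dft mulr_sumr; apply: eq_bigr => m _.
under eq_bigr do rewrite mulrAC.
by rewrite -mulr_suml dft_shift// mulrN; ring.
Qed.

(* Shifting by n first leaves sums over 0 <= m < b, where only m = 0 survives
   orthogonality, so n need not be reduced modulo b. *)
Lemma dft_inversion h (n : int) : periodic h b%:Z ->
  h n = b%:R^-1 * \sum_(k < b) dft b h k%:Z * z ^ (k%:Z * n).
Proof.
move=> hh.
under eq_bigr do rewrite mulrC -dft_shift//.
rewrite exchange_big /=.
have inner (m : 'I_b) : \sum_(k < b) h (m%:Z + n) * z ^ (- (k%:Z * m%:Z))
    = if m == 0%N :> nat then b%:R * h n else 0.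
  have -> : \sum_(k < b) h (m%:Z + n) * z ^ (- (k%:Z * m%:Z))
      = h (m%:Z + n) * \sum_(k < b) (z ^- m) ^+ k.
    rewrite mulr_sumr; apply: eq_bigr => k _; congr (_ * _).
    by rewrite exprVn -exprM -PoszM mulnC exprnN.
  rewrite (sum_prim_rootV _ _ _ _ (xi_prim_root R b b_gt0))//.
  by case: eqP => [->|]; rewrite ?add0r ?mulr0// mulrC.
rewrite (eq_bigr _ (fun m _ => inner m)) -big_mkcond (big_pred1 (Ordinal b_gt0))//.
by rewrite mulKf// pnatr_eq0 -lt0n.
Qed.

Lemma dft_inj f g : periodic f b%:Z -> periodic g b%:Z ->
  (forall k : nat, (k < b)%N -> dft b f k%:Z = dft b g k%:Z) -> f = g.
Proof.
move=> hf hg fg; apply/funext => t.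
rewrite (dft_inversion _ t hf) (dft_inversion _ t hg).
by congr (_ * _); apply: eq_bigr => k _; rewrite fg.
Qed.

(** Composition of operators is matched with multiplication of multipliers. Periodicity is carried
    along, since the outer factor acts on the output of the inner one. *)
Lemma dft_shift_prod d (a : 'I_d -> nat) h k : periodic h b%:Z ->
  periodic (shift_prod a h) b%:Z /\
  dft b (shift_prod a h) k
    = \prod_(i < d) (1 - z ^ (k * (a i)%:Z)) * dft b h k.
Proof.
move: h; rewrite /shift_prod.
apply: (big_ind2 (fun (A : (int -> R[i]) -> int -> R[i]) (c : R[i]) =>
  forall h, periodic h b%:Z ->
    periodic (A h) b%:Z /\ dft b (A h) k = c * dft b h k)).
- by move=> h hh; rewrite mul1r.
- move=> A c B e HA HB h /HB[/HA[? HAB] HBh]; split=> //=.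
  by rewrite HAB HBh mulrA.
- move=> i _ h hh.
  have -> : (idfun \- @shift_op R (a i)%:Z) h = fun t => h t - h (t + (a i)%:Z).
    by [].
  split; first by move=> t /=; rewrite hh addrAC hh.
  rewrite mulrBl mul1r -dft_shift// /dft -sumrB.
  by apply: eq_bigr => m _; rewrite -mulrBl.
Qed.

End DiscreteFourier.

(** A factor vanishes only if b divides k a_i, hence k by coprimality, which 0 < k < b excludes. *)
Lemma prod_1Bxi_neq0 (R : realType) (b d : nat) (a : 'I_d -> nat) (k : nat) :
  (forall i, coprime (a i) b) -> (0 < k < b)%N ->
  \prod_(i < d) (1 - xi R b ^ (k%:Z * (a i)%:Z)) != 0.
Proof.
move=> hab /andP[k0 kb]; apply/prodf_neq0 => i _.
rewrite subr_eq0 eq_sym -PoszM -exprnP.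
rewrite -(prim_order_dvd (xi_prim_root R _ (leq_ltn_trans (leq0n k) kb))).
by rewrite Gauss_dvdl 1?coprime_sym// gtnNdvd.
Qed.

Lemma dft0 (R : realType) (b : nat) (h : int -> R[i]) :
  dft b h 0 = \sum_(k < b) h k%:Z.
Proof.
by apply: eq_bigr => m _; rewrite mul0r oppr0 mulr1.
Qed.

Theorem theorem1 (R : realType) (b d : nat) (hb : (2 <= b)%N) (hd : (1 <= d)%N)
    (a : 'I_d -> nat) (ha : forall i : 'I_d, (0 < a i)%N)
    (hab : forall i : 'I_d, coprime (a i) b)
    (f g : int -> R[i])
    (hf : periodic f b%:Z) (hg : periodic g b%:Z)
    (hf0 : \sum_(k < b) f k%:Z = 0) (hg0 : \sum_(k < b) g k%:Z = 0) :
  (shift_prod a (conv b f g) = g <->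
     (forall k : nat, (k < b)%N -> dft b g k%:Z != 0 ->
        dft b f k%:Z = 1 / \prod_(i < d) (1 - xi R b ^ (k%:Z * (a i)%:Z))))
  /\
  ((forall k : nat, (1 <= k)%N -> (k <= b - 1)%N -> dft b g k%:Z != 0) ->
   shift_prod a (conv b f g) = g ->
   forall t : int, f t = fourier_dedekind R a b t).
Proof.
have b0 : (0 < b)%N by exact: ltnW.
have key k := dft_shift_prod R b b0 d a _ k (periodic_conv R b f g hf).
have main : shift_prod a (conv b f g) = g <->
     (forall k : nat, (k < b)%N -> dft b g k%:Z != 0 ->
        dft b f k%:Z = 1 / \prod_(i < d) (1 - xi R b ^ (k%:Z * (a i)%:Z))).
  have k_gt0 k : dft b g k%:Z != 0 -> (0 < k)%N.
    by case: k => //; rewrite dft0 hg0 eqxx.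
  split=> [E k kb gk0|H].
    have [_] := key k%:Z; rewrite E dft_conv// mulrA => /esym.
    rewrite -[RHS]mul1r => /(mulIf gk0) Pf.
    apply: (canRL (mulfK _)); last by rewrite mulrC.
    by apply: prod_1Bxi_neq0; rewrite ?k_gt0.
  apply: (dft_inj R b b0) => [||k kb]//; first by case: (key 0).
  have [_ ->] := key k%:Z; rewrite dft_conv// mulrA.
  (* Where the transform of [g] vanishes both sides are 0; elsewhere [H] applies. *)
  have [->|gk0] := eqVneq (dft b g k%:Z) 0; first by rewrite mulr0.
  by rewrite H// mul1r mulfV ?mul1r// prod_1Bxi_neq0 ?k_gt0.
split=> // gk0 /main H t.
rewrite (dft_inversion _ _ b0 _ t hf) /fourier_dedekind; congr (_ * _).
(* The inversion formula starts at frequency 0 and the Fourier-Dedekind sum at 1; the extra term is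
   0 because [f] sums to zero over a period. *)
rewrite -(big_mkord xpredT (fun k => dft b f k%:Z * xi R b ^ (k%:Z * t))).
rewrite big_ltn// dft0 hf0 mul0r add0r.
apply: eq_big_nat => k /andP[k0 kb].
rewrite H ?gk0// ?mul1r 1?mulrC//.
by rewrite subn1 -ltnS prednK.
Qed.
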